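(* Let $(X,\mathcal B,m)$ be a probability space and let $T:X\to X$ be a Marco-Martens map with a Marco-Martens cover $\{X_j\}_{j=0}^\infty$. Then there exists a $\sigma$-finite $T$-invariant measure $\mu$ on $X$ equivalent to $m$. In addition, $0<\mu(X_j)<+\infty$ for each $j\ge0$. The measure $\mu$ is constructed in the following way. Let $l_B:l_\infty\to\mathbb R$ be a Banach limit and let $Y_j:=X_j\setminus\bigcup_{i<j}X_i$ for each $j\ge0$. For each $A\in\mathcal B$ set $$m_n(A):=\frac{\sum_{k=0}^n m(T^{-k}(A))}{\sum_{k=0}^n m(T^{-k}(X_0))}.$$ If $A\in\mathcal B$ and $A\subset Y_j$ for some $j\ge0$, then $(m_n(A))_{n=1}^\infty\in l_\infty$, and one sets $\mu(A):=l_B((m_n(A))_{n=1}^\infty)$. For a general measurable set $A\subset X$ one sets $\mu(A):=\sum_{j=0}^\infty\mu(A\cap Y_j)$. In addition, if for a measurable subset $A\subset X$ the sequence $(m_n(A))_{n=1}^\infty$ is bounded, then $$\mu(A)=l_B((m_n(A))_{n=1}^\infty)-\lim_{l\to\infty}l_B\Big(\Big(m_n\Big(A\cap\bigcup_{j=l}^\infty Y_j\Big)\Big)_{n=1}^\infty\Big).$$ Furthermore, if the transformation $T:X\to X$ is ergodic (equivalently with respect to the measure $m$ or $\mu$), then the $\sigma$-finite $T$-invariant measure $\mu$ equivalent to $m$ is unique up to a multiplicative constant.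
   Context: Let $(X,\mathcal B,m)$ be a probability space and $T:X\to X$ a measurable map such that $T(A)\in\mathcal B$ whenever $A\in\mathcal B$, and such that $m$ is quasi-invariant with respect to $T$, meaning that $m\circ T^{-1}$ is absolutely continuous with respect to $m$. Then $T$ is called a Marco-Martens map, and $\{X_n\}_{n=0}^\infty$ a Marco-Martens cover, if $\{X_n\}_{n=0}^\infty$ is a countable family of subsets of $X$ such that: (1) $X_n\in\mathcal B$ for all $n\ge0$. (2) $m(X\setminus\bigcup_{n=0}^\infty X_n)=0$. (3) For all $k,n\ge0$ there exists $j\ge0$ such that $m(X_k\cap T^{-j}(X_n))>0$. (4) For all $j\ge0$ there exists $K_j\ge1$ such that for all $A,B\in\mathcal B$ with $A,B\subset X_j$ and all $n\ge0$, $m(T^{-n}(A))\,m(B)\le K_j\,m(A)\,m(T^{-n}(B))$. (5) $\sum_{n=0}^\infty m(T^{-n}(X_0))=+\infty$. (6) $\lim_{l\to\infty}m\big(T(\bigcup_{j=l}^\infty Y_j)\big)=0$, where $Y_j:=X_j\setminus\bigcup_{i<j}X_i$. $l_\infty$ is the Banach space of bounded real sequences; a Banach limit is a positive, shift-invariant, norm-one linear functional on $l_\infty$ extending the ordinary limit. A measure $\mu$ is $T$-invariant if $\mu\circ T^{-1}=\mu$; $T$ is ergodic with respect to $m$ if $m(A)=0$ or $m(X\setminus A)=0$ for every measurable $A$ with $T^{-1}(A)=A$. *)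

(* Defs.v *)
From HB Require Import structures.
From mathcomp Require Import all_boot all_order all_algebra.
From mathcomp Require Import all_classical all_reals all_analysis.

Set Implicit Arguments.
Unset Strict Implicit.
Unset Printing Implicit Defensive.

Import Order.TTheory GRing.Theory Num.Theory.
Import numFieldNormedType.Exports.

Local Open Scope classical_set_scope.
Local Open Scope ring_scope.
Local Open Scope ereal_scope.

(* A functional on l_oo is represented by a total function on real sequences,
   constrained only on the bounded ones; its values elsewhere are junk. *)
Record banach_limit (R : realType) (l : R^nat -> R) : Prop := BanachLimit {
  banach_limit_linear : forall (a : R) (u v : R^nat),
    bounded_fun u -> bounded_fun v ->
    l (fun n => a * u n + v n)%R = (a * l u + l v)%R;
  banach_limit_ge0 : forall u : R^nat, bounded_fun u ->
    (forall n, 0 <= u n)%R -> (0 <= l u)%R;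
  banach_limit_shift : forall u : R^nat, bounded_fun u ->
    l (fun n => u n.+1) = l u;
  (* [sup] is 0 on sets without a supremum, so the value 1 also says that the
     set is bounded above, i.e. that the functional is bounded. *)
  banach_limit_norm1 :
    sup [set `|l u|%R | u in [set u : R^nat | forall n, (`|u n| <= 1)%R]] = 1%R;
  banach_limit_lim : forall (u : R^nat) (x : R), u @ \oo --> x -> l u = x }.

Section marco_martens.
Context (R : realType) (d : measure_display) (X : measurableType d).
Implicit Types (m : probability X R) (mu nu : set X -> \bar R) (T : X -> X).
Implicit Types (Xs : (set X)^nat) (A : set X) (l : R^nat -> R).

(* The sets Y_j of the disjointified cover are [seqDU Xs j]. *)
Record marco_martens_cover m T Xs : Prop := MarcoMartensCover {
  mm_measurable : forall n, measurable (Xs n);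
  mm_cover : m (~` \bigcup_n Xs n) = 0;
  mm_transitive : forall k n, exists j : nat,
    0 < m (Xs k `&` iter j T @^-1` Xs n);
  mm_distortion : forall j, exists2 K : R, (1 <= K)%R &
    forall A B, measurable A -> measurable B ->
      A `<=` Xs j -> B `<=` Xs j ->
      forall n : nat, m (iter n T @^-1` A) * m B <=
                      K%:E * (m A * m (iter n T @^-1` B));
  mm_divergent : \sum_(0 <= n <oo) m (iter n T @^-1` Xs 0%N) = +oo;
  mm_tail : (fun l : nat => m (T @` \bigcup_(j >= l) seqDU Xs j)) @ \oo --> 0 }.

Definition marco_martens_map m T : Prop :=
  [/\ measurable_fun setT T,
      (forall A, measurable A -> measurable (T @` A)),
      pushforward m T `<< m &
      exists Xs, marco_martens_cover m T Xs].

Definition invariant_measure T mu : Prop :=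
  forall A, measurable A -> pushforward mu T A = mu A.

Definition equivalent_measures mu nu : Prop := mu `<< nu /\ nu `<< mu.

Definition sigma_finite_invariant_equivalent m T mu : Prop :=
  [/\ sigma_finite setT mu, invariant_measure T mu & equivalent_measures mu m].

Definition ergodic T mu : Prop :=
  forall A, measurable A -> T @^-1` A = A -> mu A = 0 \/ mu (~` A) = 0.

(* [mm_ratio m T Xs n A] is m_n(A); all the measures involved are finite, so
   [fine] loses nothing. *)
Definition mm_ratio m T Xs (n : nat) A : R :=
  ((\sum_(0 <= k < n.+1) fine (m (iter k T @^-1` A))) /
   (\sum_(0 <= k < n.+1) fine (m (iter k T @^-1` Xs 0%N))))%R.

(* (m_n(A))_{n >= 1} *)
Definition mm_seq m T Xs A : R^nat := fun n => mm_ratio m T Xs n.+1 A.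

Definition mm_local m T Xs l A : \bar R := (l (mm_seq m T Xs A))%:E.

Definition mm_measure m T Xs l A : \bar R :=
  \sum_(0 <= j <oo) mm_local m T Xs l (A `&` seqDU Xs j).

End marco_martens.

(* Main.v *)
Require Import Defs.
From HB Require Import structures.
From mathcomp Require Import all_boot all_order all_algebra.
From mathcomp Require Import all_classical all_reals all_analysis.
From mathcomp Require Import ring lra.

(** Existence.  Write [S_n(A)] for the sum of the measures of the preimages of A
    under the first iterates of T (up to order [n]).  Bounded distortion makes
    [S_n] comparable, on each [X_j], to a multiple of [m]; transitivity of the
    cover makes the multiple comparable to [S_n(X_0)], up to a bounded error
    which is negligible because [S_n(X_0)] diverges ([occupation_le],
    [occupation_ge]).  Hence a Banach limit of [S_n / S_n(X_0)] is, on each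
    [Y_j], a finitely additive function lying between two positive multiples of
    [m].  The upper bound makes it countably additive
    ([dominated_additive_measure]); the lower bound makes the sum over [j] of
    these measures equivalent to [m].

    Invariance.  Passing from A to its preimage changes [S_n] by a bounded
    amount, so it does not change the Banach limit ([loc_preimage]).  What is
    left is that the Banach limit, which is only finitely additive, loses no
    mass when the preimage of a subset of [Y_j] spreads over infinitely many
    cells; the smallness of the images of the tails of the cover gives this
    ([limit_measure_tail], [limit_measure_preimage_local]).  Banach limits are
    obtained as ultrafilter limits of Cesaro means.

    Uniqueness.  Invariant measures of an ergodic map can fail to be
    proportional if the map is not conservative, so conservativity has to be
    extracted from the cover: a wandering set W has [S_n(W) <= 1], which the
    lower bound on [S_n] forbids if W has positive measure
    ([cover_conservative]).  For a conservative map every excessive measure is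
    invariant ([excessive_invariant]).  Apply this to the minimum of [nu] and
    [c mu], built from a Hahn decomposition: its invariance, together with the
    fact that under ergodicity the preimages of a non null set sweep out the
    space ([ergodic_sweep]), forces [nu <= c mu] or [c mu <= nu] globally
    ([invariant_measures_comparable]).  Letting [c] vary around the ratio
    of the two measures on one set gives proportionality. *)

Set Implicit Arguments.
Unset Strict Implicit.
Unset Printing Implicit Defensive.

Import Order.TTheory GRing.Theory Num.Theory.
Import numFieldNormedType.Exports.

Local Open Scope classical_set_scope.
Local Open Scope ring_scope.
Local Open Scope ereal_scope.

(** * Banach limits *)

Lemma bounded_seqP (R : realType) (u : R^nat) :
  bounded_fun u <-> exists M : R, forall n, (`|u n| <= M)%R.
Proof.
have FF : ProperFilter (globally [set: nat]).
  exact: (@globally_properfilter _ _ 0%N).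
split=> [bu|[M uM]].
  have /ex_bound[M uM] : bounded_near (u : nat -> R^o) (globally setT) by [].
  by exists M => n; exact: uM.
suff : bounded_near (u : nat -> R^o) (globally setT) by [].
by apply/ex_bound; exists M => n _; exact: uM.
Qed.

Lemma bounded_seqD (R : realType) (u v : R^nat) :
  bounded_fun u -> bounded_fun v -> bounded_fun (fun n => u n + v n)%R.
Proof. exact: bounded_funD. Qed.

Section banach_limit_theory.
Local Open Scope ring_scope.
Context (R : realType) (l : R^nat -> R).
Hypothesis hl : banach_limit l.
Implicit Types u v : R^nat.

Lemma banach_limit_cst (c : R) : l (fun=> c) = c.
Proof. by apply: (banach_limit_lim hl); exact: cvg_cst. Qed.

Lemma banach_limitD u v : bounded_fun u -> bounded_fun v ->
  l (fun n => u n + v n) = l u + l v.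
Proof.
move=> bu bv; have := banach_limit_linear hl 1 bu bv; rewrite mul1r => <-.
by congr l; apply/funext => n; rewrite mul1r.
Qed.

Lemma bounded_seqB u v : bounded_fun u -> bounded_fun v ->
  bounded_fun (fun n => v n - u n).
Proof.
move=> /bounded_seqP[M uM] /bounded_seqP[N vN]; apply/bounded_seqP.
by exists (N + M) => n; rewrite (le_trans (ler_normB _ _))// lerD.
Qed.

Lemma banach_limitB u v : bounded_fun u -> bounded_fun v ->
  l (fun n => v n - u n) = l v - l u.
Proof.
move=> bu bv; apply/eqP; rewrite eq_sym subr_eq; apply/eqP.
rewrite -banach_limitD//; last exact: bounded_seqB.
by congr l; apply/funext => n; rewrite subrK.
Qed.

Lemma le_banach_limit u v : bounded_fun u -> bounded_fun v ->
  (forall n, u n <= v n) -> l u <= l v.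
Proof.
move=> bu bv uv; rewrite -subr_ge0 -banach_limitB//.
apply: (banach_limit_ge0 hl); first exact: bounded_seqB.
by move=> n; rewrite subr_ge0.
Qed.

Lemma banach_limit_asymptotic u v : bounded_fun u ->
  (fun n => v n - u n) @ \oo --> (0 : R) -> l v = l u.
Proof.
move=> bu uv0; have buv : bounded_fun (fun n => v n - u n).
  by apply: cvg_seq_bounded; apply/cvg_ex; exists 0.
rewrite -[RHS]add0r -(banach_limit_lim hl uv0) -banach_limitD//.
by congr l; apply/funext => n; rewrite subrK.
Qed.

End banach_limit_theory.

Section banach_limit_existence.
Local Open Scope ring_scope.
Context (R : realType) (U : set_system nat).
Hypotheses (UF : UltraFilter U) (oU : \oo `<=` U).

Lemma arithmetic_mean_le (u : R^nat) (M : R) : (forall n, `|u n| <= M) ->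
  forall n, `|arithmetic_mean u n| <= M.
Proof.
move=> uM n; rewrite /arithmetic_mean /= normrM ger0_norm ?invr_ge0//.
rewrite ler_pdivrMl// (le_trans (ler_norm_sum _ _ _))//.
have -> : n.+1%:R * M = \sum_(0 <= i < n.+1) M.
  by rewrite sumr_const_nat subn0 mulr_natl.
exact: ler_sum.
Qed.

(** Ultrafilters converge on compact sets; through this lemma, every bounded
    sequence converges along U. *)
Lemma fmap_ultra (T S : Type) (f : T -> S) (F : set_system T) :
  UltraFilter F -> UltraFilter (fmap f F).
Proof.
move=> FU; split; first exact: fmap_proper_filter.
move=> G PG fFG; apply/seteqP; split=> [A GA|]; last exact: fFG.
have [//|FnA] := in_ultra_setVsetC (f @^-1` A) FU.
have /filter_ex[x []//] : G (A `&` ~` A).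
by apply: filterI => //; exact: fFG.
Qed.

Lemma arithmetic_mean_cvg_ultra (u : R^nat) : bounded_fun u ->
  arithmetic_mean u @ U --> lim (arithmetic_mean u @ U).
Proof.
move=> /bounded_seqP[M /arithmetic_mean_le uM].
have := @segment_compact R (- M) M; rewrite compact_ultra.
move=> /(_ (arithmetic_mean u @ U)) [||x [_ ux]].
- exact: fmap_ultra.
- apply: (@filterE _ U) => n /=.
  by rewrite in_itv/= -ler_norml.
- by apply/cvg_ex; exists x.
Qed.

Definition ultra_mean_limit (u : R^nat) : R := lim (arithmetic_mean u @ U).

Lemma ultra_mean_limitE (u : R^nat) (x : R) :
  arithmetic_mean u @ U --> x -> ultra_mean_limit u = x.
Proof. by move=> ux; exact: cvg_lim. Qed.

Lemma arithmetic_mean_linear (a : R) (u v : R^nat) n :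
  arithmetic_mean (fun n => a * u n + v n) n =
  a * arithmetic_mean u n + arithmetic_mean v n.
Proof.
rewrite /arithmetic_mean /= mulrCA -mulrDr; congr (_ * _).
by rewrite /series /= big_split/= mulr_sumr.
Qed.

Lemma ultra_mean_limit_linear (a : R) (u v : R^nat) :
  bounded_fun u -> bounded_fun v ->
  ultra_mean_limit (fun n => a * u n + v n) =
  a * ultra_mean_limit u + ultra_mean_limit v.
Proof.
move=> /arithmetic_mean_cvg_ultra ul /arithmetic_mean_cvg_ultra vl.
apply: ultra_mean_limitE.
rewrite (funext (arithmetic_mean_linear a u v)).
by apply: cvgD => //; apply: cvgM => //; exact: cvg_cst.
Qed.

Lemma ultra_mean_limit_ge0 (u : R^nat) : bounded_fun u ->
  (forall n, 0 <= u n) -> 0 <= ultra_mean_limit u.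
Proof.
move=> /arithmetic_mean_cvg_ultra ul u0; apply: limr_ge.
  by apply/cvg_ex; eexists; exact: ul.
by apply: nearW => n; rewrite /arithmetic_mean/= mulr_ge0// sumr_ge0.
Qed.

Lemma ultra_mean_limit_cvg (u : R^nat) (x : R) : u @ \oo --> x ->
  ultra_mean_limit u = x.
Proof.
move=> /cesaro ux; apply: ultra_mean_limitE.
by apply: cvg_trans ux => A; exact: oU.
Qed.

(** Cesaro averaging before passing to the ultrafilter limit is what yields
    shift invariance: the means of a sequence and of its shift differ by
    [(u n.+1 - u 0) / n.+1]. *)
Lemma ultra_mean_limit_shift (u : R^nat) : bounded_fun u ->
  ultra_mean_limit (fun n => u n.+1) = ultra_mean_limit u.
Proof.
move=> bu; apply: ultra_mean_limitE.
rewrite -[ultra_mean_limit u]addr0.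
have -> : arithmetic_mean (fun n => u n.+1) =
    (fun n => arithmetic_mean u n + n.+1%:R^-1 * (u n.+1 - u 0%N)).
  apply/funext => n; rewrite /arithmetic_mean/= -mulrDr; congr (_ * _).
  apply: (@addrI _ (u 0%N)); rewrite /series/= -big_nat_recl//.
  by rewrite big_nat_recr//= [in RHS]addrC -addrA subrK.
apply: cvgD; first exact: arithmetic_mean_cvg_ultra.
suff : (fun n => n.+1%:R^-1 * (u n.+1 - u 0%N)) @ \oo --> (0 : R).
  by move=> h; apply: cvg_trans h => A; exact: oU.
have /bounded_seqP[M uM] := bu.
apply: (@squeeze_cvgr _ _ _ _ (fun n => - (n.+1%:R^-1 * (2 * M)))
  (fun n => n.+1%:R^-1 * (2 * M))).
- apply: nearW => n; rewrite -ler_norml normrM ger0_norm ?invr_ge0//.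
  rewrite ler_wpM2l ?invr_ge0// (le_trans (ler_normB _ _))//.
  by rewrite mulr2n mulrDl !mul1r lerD.
- rewrite -oppr0; apply: cvgN; rewrite -[X in _ --> X](mul0r (2 * M)).
  by apply: cvgM; [exact: cvg_harmonic|exact: cvg_cst].
- rewrite -[X in _ --> X](mul0r (2 * M)).
  by apply: cvgM; [exact: cvg_harmonic|exact: cvg_cst].
Qed.

Lemma ultra_mean_banach_limit : banach_limit ultra_mean_limit.
Proof.
have l1 (c : R) : ultra_mean_limit (fun=> c) = c.
  by apply: ultra_mean_limit_cvg; exact: cvg_cst.
have le1 (u : R^nat) : (forall n, `|u n| <= 1) -> `|ultra_mean_limit u| <= 1.
  move=> u1.
  have /arithmetic_mean_cvg_ultra ul : bounded_fun u.
    by apply/bounded_seqP; exists 1.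
  have cu : cvg (arithmetic_mean u @ U) by apply/cvg_ex; eexists; exact: ul.
  have {}u1 := arithmetic_mean_le u1.
  rewrite ler_norml; apply/andP; split.
    apply: limr_ge => //; apply: nearW => n.
    by have := u1 n; rewrite ler_norml => /andP[].
  apply: limr_le => //; apply: nearW => n.
  by have := u1 n; rewrite ler_norml => /andP[].
split.
- exact: ultra_mean_limit_linear.
- exact: ultra_mean_limit_ge0.
- exact: ultra_mean_limit_shift.
- apply/eqP; rewrite eq_le; apply/andP; split.
    apply: ge_sup => [|_ [u /= u1 <-]]; last exact: le1.
    exists `|ultra_mean_limit (fun=> 0)|; exists (fun=> 0) => // n /=.
    by rewrite normr0.
  apply: ub_le_sup; first by exists 1 => _ [u /= u1 <-]; exact: le1.
  by exists (fun=> 1) => [n /=|]; rewrite ?l1 normr1.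
- exact: ultra_mean_limit_cvg.
Qed.

End banach_limit_existence.

Lemma exists_banach_limit (R : realType) :
  exists l : R^nat -> R, banach_limit l.
Proof.
have [U [UF oU]] := ultraFilterLemma (F := \oo) _.
by exists (@ultra_mean_limit R U); exact: ultra_mean_banach_limit.
Qed.

(** * Measures *)

Lemma bigcup_geS (X : Type) (F : (set X)^nat) n :
  \bigcup_(k >= n) F k = F n `|` \bigcup_(k >= n.+1) F k.
Proof.
apply/seteqP; split=> x.
  move=> [k /= nk Fkx]; have [kn|kn] := eqVneq k n; first by left; rewrite -kn.
  by right; exists k => //=; rewrite ltn_neqAle eq_sym kn.
by move=> [Fx|[k /= nk Fkx]]; [exists n => /=|exists k => //=; exact: ltnW].
Qed.

Lemma trivIset_bigcup_geS (X : Type) (F : (set X)^nat) n :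
  trivIset setT F -> F n `&` \bigcup_(k >= n.+1) F k = set0.
Proof.
move=> tF; apply/seteqP; split=> // x [Fnx [k /= nk Fkx]].
have nk' : n = k by apply: tF => //; exists x.
by rewrite nk' ltnn in nk.
Qed.

Lemma bigcup_ge0 (X : Type) (F : (set X)^nat) :
  \bigcup_(k >= 0) F k = \bigcup_k F k.
Proof. by apply/seteqP; split=> x [k _ Fkx]; exists k. Qed.

Section measure_tools.
Context (R : realType) (d : measure_display) (X : measurableType d).
Implicit Types (mu nu : {measure set X -> \bar R}) (A B : set X).

Lemma le_measureS mu A B : measurable A -> measurable B -> A `<=` B ->
  mu A <= mu B.
Proof. by move=> mA mB AB; rewrite le_measure// inE. Qed.

Lemma measure_eq0S mu A B : measurable A -> measurable B -> A `<=` B ->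
  mu B = 0 -> mu A = 0.
Proof.
by move=> mA mB AB B0; apply/eqP; rewrite -measure_le0 -B0 le_measureS.
Qed.

Lemma measure_setID mu A B : measurable A -> measurable B ->
  mu A = mu (A `&` B) + mu (A `&` ~` B).
Proof. by move=> mA mB; rewrite -setDE addeC; exact: measureDI. Qed.

Lemma measure_setI_conull mu A B : measurable A -> measurable B ->
  mu (~` B) = 0 -> mu A = mu (A `&` B).
Proof.
move=> mA mB B0; rewrite (measure_setID mu mA mB).
have mBC := measurableC mB.
by rewrite [X in _ + X](measure_eq0S _ mBC _ B0) ?adde0//; exact: measurableI.
Qed.

Lemma measure_partition mu (D : (set X)^nat) A :
  (forall n, measurable (D n)) -> trivIset setT D -> measurable A ->
  mu (~` \bigcup_n D n) = 0 -> mu A = \sum_(0 <= n <oo) mu (A `&` D n).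
Proof.
move=> mD tD mA D0.
rewrite (measure_setI_conull mA (bigcupT_measurable _ mD) D0) setI_bigcupr.
have mAD n : measurable (A `&` D n) by exact: measurableI.
rewrite measure_semi_bigcup//; last exact: bigcupT_measurable.
exact: trivIset_setIl.
Qed.

Lemma measure_bigcup_eq0 mu (F : (set X)^nat) : (forall n, measurable (F n)) ->
  (forall n, mu (F n) = 0) -> mu (\bigcup_n F n) = 0.
Proof.
move=> mF F0; have mUF := bigcupT_measurable F mF.
have /(negligibleP mu mUF) // : mu.-negligible (\bigcup_n F n).
by apply: negligible_bigcup => n; apply: (negligibleP mu (mF n)).2; exact: F0.
Qed.

Lemma null_dominatesP mu (nu : set X -> \bar R) A :
  nu `<< mu -> measurable A -> mu A = 0 -> nu A = 0.
Proof. by move=> numu mA /(measure0_null_setP mu mA)/numu; exact. Qed.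

(** Domination by a finite measure is what promotes a finitely additive
    function to a countably additive one: the tails of a disjoint union have
    small measure. *)
Lemma dominated_additive_measure (m : probability X R) (f : set X -> R) (C : R) :
  (forall A, measurable A -> (0 <= f A)%R) ->
  (forall A B, measurable A -> measurable B -> A `&` B = set0 ->
    f (A `|` B) = (f A + f B)%R) ->
  (forall A, measurable A -> (f A)%:E <= C%:E * m A) ->
  exists mu : {measure set X -> \bar R},
    forall A, measurable A -> mu A = (f A)%:E.
Proof.
(* A measure must be nonnegative on non measurable sets too, hence the max. *)
move=> f0 fD fm; pose g A : \bar R := (Num.max 0 (f A))%:E.
have gE A : measurable A -> g A = (f A)%:E by move=> mA; rewrite /g max_r// f0.
have fset0 : f set0 = 0%R.
  have := fD set0 set0 measurable0 measurable0 (setI0 _).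
  by rewrite setU0 => /esym/eqP; rewrite -subr_eq0 addrK => /eqP.
have g0 : g set0 = 0 by rewrite gE// fset0.
have g_ge0 A : 0 <= g A by rewrite lee_fin le_max lexx.
have gsa : semi_sigma_additive g.
  move=> F mF tF mUF; pose t n := \bigcup_(k >= n) F k.
  have mt n : measurable (t n) by apply: bigcup_measurable => k _.
  have sumE n : \sum_(0 <= i < n) g (F i) = (f (\bigcup_n F n) - f (t n))%:E.
    elim: n => [|n IHn].
      by rewrite big_nil /t bigcup_ge0 subrr.
    rewrite big_nat_recr//= IHn gE// -EFinD [in LHS]/t bigcup_geS.
    rewrite fD//; [|exact: mt|exact: trivIset_bigcup_geS].
    by congr EFin; rewrite opprD addrA addrAC subrK.
  under eq_fun do rewrite sumE.
  rewrite gE//; apply: cvg_EFin; first exact: nearW.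
  rewrite -[X in _ --> X]subr0; apply: cvgB; first exact: cvg_cst.
  have mt0 : m (t n) @[n --> \oo] --> 0.
    rewrite -(measure0 m); have -> : set0 = lim_sup_set F.
      apply/seteqP; split=> // x Fx.
      have [j _ Fjx] := Fx 0%N I; have [k /= jk Fkx] := Fx j.+1 I.
      have jk' : j = k by apply: tF => //; exists x.
      by rewrite jk' ltnn in jk.
    apply: lim_sup_set_cvg => //.
    by apply: (le_lt_trans (probability_le1 _ (mt 0%N))); exact: ltry.
  have Cm0 : (C * fine (m (t n)))%R @[n --> \oo] --> (0%R : R).
    rewrite -[X in _ --> X](mulr0 C); apply: cvgM; first exact: cvg_cst.
    exact: (fine_cvg mt0).
  apply: (squeeze_cvgr _ (cvg_cst (0%R : R)) Cm0).
  apply: nearW => n; rewrite f0//= -lee_fin EFinM fineK ?fm//.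
  exact: fin_num_measure.
pose mu : {measure set X -> \bar R} :=
  HB.pack g (isMeasure.Build _ _ _ g g0 g_ge0 gsa).
by exists mu.
Qed.

Lemma common_sigma_finite_cover mu nu :
  sigma_finite setT mu -> sigma_finite setT nu ->
  exists F : (set X)^nat, \bigcup_n F n = setT /\
    forall n, [/\ measurable (F n), mu (F n) < +oo & nu (F n) < +oo].
Proof.
move=> /sigma_finiteP[F [TF ndF Ffin]] /sigma_finiteP[G [TG ndG Gfin]].
exists (fun n => F n `&` G n); split=> [|n].
  apply/seteqP; split=> // x _.
  have [i _ Fix] : (\bigcup_n F n) x by rewrite -TF.
  have [j _ Gjx] : (\bigcup_n G n) x by rewrite -TG.
  exists (maxn i j) => //; split.
    by move: Fix; apply/subsetPset/ndF; exact: leq_maxl.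
  by move: Gjx; apply/subsetPset/ndG; exact: leq_maxr.
have [[mF Foo] [mG Goo]] := (Ffin n, Gfin n); split.
- exact: measurableI.
- by apply: le_lt_trans Foo; apply: measureIl.
- by apply: le_lt_trans Goo; apply: measureIr.
Qed.

(** The Hahn decomposition of the difference of the two measures needs both to
    be finite, so it is taken separately on each cell of a partition into cells
    of finite measure. *)
Lemma sigma_finite_hahn mu nu :
  sigma_finite setT mu -> sigma_finite setT nu ->
  exists E, [/\ measurable E,
    (forall A, measurable A -> A `<=` E -> nu A <= mu A) &
    (forall A, measurable A -> A `<=` ~` E -> mu A <= nu A)].
Proof.
move=> sfmu sfnu; have [F [TF Ffin]] := common_sigma_finite_cover sfmu sfnu.
have mF n : measurable (F n) by have [] := Ffin n.
pose D := seqDU F.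
have mD n : measurable (D n) by exact: seqDU_measurable.
have tD : trivIset setT D by exact: trivIset_seqDU.
have TD : \bigcup_n D n = setT by rewrite -seqDU_bigcup_eq.
have split_ mu' A : measurable A -> mu' A = \sum_(0 <= n <oo) mu' (A `&` D n).
  by move=> mA; apply: measure_partition => //; rewrite TD setCT.
have muD n : mu (D n) < +oo.
  have [_ Foo _] := Ffin n; apply: le_lt_trans Foo.
  exact: le_measureS (@subset_seqDU _ _ _).
have nuD n : nu (D n) < +oo.
  have [_ _ Foo] := Ffin n; apply: le_lt_trans Foo.
  exact: le_measureS (@subset_seqDU _ _ _).
have /choice[P hP] n : exists P, [/\ measurable P,
    (forall A, measurable A -> A `<=` D n -> A `<=` P -> nu A <= mu A) &
    (forall A, measurable A -> A `<=` D n -> A `<=` ~` P -> mu A <= nu A)].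
  pose mu1 := charge_of_finite_measure (mfrestr (mD n) (muD n)).
  pose nu1 := charge_of_finite_measure (mfrestr (mD n) (nuD n)).
  pose s := cadd mu1 (copp nu1).
  have sE A : measurable A -> A `<=` D n -> s A = mu A - nu A.
    by move=> mA AD; rewrite -[in RHS](setIidl AD).
  have finA A : measurable A -> A `<=` D n -> nu A \is a fin_num.
    move=> mA AD; rewrite ge0_fin_numE//.
    by apply: le_lt_trans (nuD n); exact: le_measureS.
  have [P [N [[mP posP] [mN negN] PN PN0]]] := Hahn_decomposition s.
  exists P; split => // A mA AD AP; last first.
    rewrite -sube_le0 -sE//; apply: negN => // x Ax.
    have : (P `|` N) x by rewrite PN.
    by case=> // Px; have := AP _ Ax.
  by rewrite -sube_ge0 ?finA// -sE//; apply: posP.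
exists (\bigcup_n (P n `&` D n)); split.
- by apply: bigcupT_measurable => n; apply: measurableI => //; have [] := hP n.
- move=> A mA AE; rewrite (split_ nu)// (split_ mu)//.
  apply: lee_nneseries => // n _; have [_ + _] := hP n; apply.
  + exact: measurableI.
  + exact: subIsetr.
  + move=> x [Ax Dnx]; have [k _ [Pkx Dkx]] := AE x Ax.
    by have -> : n = k by apply: tD => //; exists x.
- move=> A mA AE; rewrite (split_ nu)// (split_ mu)//.
  apply: lee_nneseries => // n _; have [_ _] := hP n; apply.
  + exact: measurableI.
  + exact: subIsetr.
  + by move=> x [Ax Dnx] Pnx; apply: (AE x Ax); exists n.
Qed.

End measure_tools.

(** * Conservative maps and excessive measures *)

Section recurrence.
Context (R : realType) (d : measure_display) (X : measurableType d).
Context (m : probability X R) (T : X -> X).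
Hypotheses (mT : measurable_fun setT T) (qiT : pushforward m T `<< m).
Implicit Types (mu nu lam : {measure set X -> \bar R}) (A B : set X).

Lemma measurable_preimage A : measurable A -> measurable (T @^-1` A).
Proof. by move=> mA; rewrite -[X in measurable X]setTI; exact: mT. Qed.

Lemma iter_preimageS n A : iter n.+1 T @^-1` A = T @^-1` (iter n T @^-1` A).
Proof. by apply/funext => x /=; rewrite -iterS iterSr. Qed.

Lemma measurable_iter_preimage n A :
  measurable A -> measurable (iter n T @^-1` A).
Proof.
move=> mA; elim: n => [//|n IHn].
by rewrite iter_preimageS; exact: measurable_preimage.
Qed.

Lemma null_preimage A : measurable A -> m A = 0 -> m (T @^-1` A) = 0.
Proof. by move=> mA A0; exact: (null_dominatesP qiT mA A0). Qed.

Lemma null_iter_preimage n A :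
  measurable A -> m A = 0 -> m (iter n T @^-1` A) = 0.
Proof.
move=> mA A0; elim: n => [//|n IHn].
rewrite iter_preimageS.
by apply: null_preimage => //; exact: measurable_iter_preimage.
Qed.

Definition never_return A := A `\` \bigcup_k iter k.+1 T @^-1` A.

(** Poincare recurrence for every measurable set, which amounts to the absence of
    wandering sets of positive measure. *)
Definition conservative := forall A, measurable A -> m (never_return A) = 0.

Lemma measurable_never_return A : measurable A -> measurable (never_return A).
Proof.
move=> mA; apply: measurableD => //; apply: bigcupT_measurable => k.
exact: measurable_iter_preimage.
Qed.

(** The last visit of an orbit to A is a point of A that never returns. *)
Lemma last_visit n A x : A x -> (forall j, (n <= j)%N -> ~ A (iter j T x)) ->
  exists j, never_return A (iter j T x).
Proof.
move=> Ax; elim: n => [nA|n IHn nA]; first by have := nA 0%N isT Ax.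
have [Anx|nAnx] := pselect (A (iter n T x)).
  exists n; split=> // -[k _ /=]; rewrite -iterS -iterD.
  by apply: nA; rewrite addSn ltnS leq_addl.
apply: IHn => j; rewrite leq_eqVlt => /predU1P[<- //|]; exact: nA.
Qed.

(** The set of points visiting A infinitely often is strictly invariant and,
    by conservativity, contains almost all of A; ergodicity makes it conull. *)
Lemma ergodic_sweep A : conservative -> ergodic T m -> measurable A ->
  m A != 0 -> m (~` \bigcup_n iter n T @^-1` A) = 0.
Proof.
move=> cT eT mA A0; pose F n := iter n T @^-1` A.
have mF n : measurable (F n) by exact: measurable_iter_preimage.
have mV : measurable (lim_sup_set F).
  by apply: bigcap_measurable => // k _; exact: bigcup_measurable.
have TV : T @^-1` lim_sup_set F = lim_sup_set F.
  apply/seteqP; split=> x Vx n _ /=.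
    have [k /= nk Fk] := Vx n I; exists k.+1 => /=; first exact: leqW.
    by move: Fk; rewrite /F /= -iterS iterSr.
  have [[//|k] /= nk Fk] := Vx n.+1 I; exists k => //=.
  by move: Fk; rewrite /F /= -iterS iterSr.
have mN n : measurable (iter n T @^-1` never_return A).
  by apply: measurable_iter_preimage; exact: measurable_never_return.
have N0 : m (\bigcup_n iter n T @^-1` never_return A) = 0.
  apply: measure_bigcup_eq0 => // n; apply: null_iter_preimage.
    exact: measurable_never_return.
  exact: cT.
have AV : A `<=` lim_sup_set F `|` \bigcup_n iter n T @^-1` never_return A.
  move=> x Ax.
  have [|nN] := pselect ((\bigcup_n iter n T @^-1` never_return A) x).
    by right.
  left=> n _; apply: contrapT => nV; apply: nN.
  have [|j jx] := @last_visit n A x Ax; last by exists j.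
  by move=> j nj Aj; apply: nV; exists j.
have VF : (~` \bigcup_n F n) `<=` ~` lim_sup_set F.
  by apply: subsetC => x Vx; have [k _ Fk] := Vx 0%N I; exists k.
have [V0|] := eT _ mV TV; last first.
  apply: measure_eq0S VF; apply: measurableC => //.
  exact: bigcupT_measurable.
exfalso; move/eqP: A0; apply; apply: (measure_eq0S mA _ AV).
  by apply: measurableU => //; exact: bigcupT_measurable.
by apply: null_set_setU => //; exact: bigcupT_measurable.
Qed.

Section excessive.
Variable B : set X.

(** [first_entry n] is the set of points whose first visit to B at a positive
    time happens at time [n.+1]. *)
Fixpoint first_entry n :=
  if n is n'.+1 then T @^-1` (first_entry n' `\` B) else T @^-1` B.

Lemma measurable_first_entry n : measurable B -> measurable (first_entry n).
Proof.
move=> mB; elim: n => [|n IHn] /=; apply: measurable_preimage => //.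
exact: measurableD.
Qed.

Lemma first_entryP k x : B (iter k.+1 T x) -> exists j, first_entry j x.
Proof.
elim: k x => [|k IHk] x; first by exists 0%N.
rewrite iterSr => /IHk[j jTx]; have [BTx|BTx] := pselect (B (T x)).
  by exists 0%N.
by exists j.+1.
Qed.

(** Splitting the points that enter B for the first time at time [n.+1]
    according to whether they start in B, excessiveness bounds the mass of
    those entering at time [n.+2] by the mass of those starting outside. The
    masses of the returns to B thus add up to at most the mass of the preimage
    of B, and by conservativity almost all of B returns. *)
Lemma excessive_invariant lam : conservative -> lam `<< m ->
  (forall A, measurable A -> lam (T @^-1` A) <= lam A) ->
  measurable B -> lam (T @^-1` B) = lam B.
Proof.
move=> cT lm exc mB; apply/eqP; rewrite eq_le exc//=.
have mE n : measurable (first_entry n) by exact: measurable_first_entry.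
have bound n : \sum_(0 <= k < n) lam (B `&` first_entry k) +
    lam (first_entry n) <= lam (T @^-1` B).
  elim: n => [|n IHn]; first by rewrite big_nil add0e.
  apply: le_trans IHn; rewrite big_nat_recr//= -addeA leeD2l//.
  rewrite [leRHS](measure_setID _ (mE n) mB) setIC leeD2l// -setDE.
  by apply: exc; exact: measurableD.
have mN := measurable_never_return mB.
have N0 : lam (never_return B) = 0 by exact: (null_dominatesP lm mN (cT _ mB)).
have -> : lam B = lam (B `\` never_return B).
  rewrite (measure_setID _ mB mN) -setDE [X in X + _](_ : _ = 0) ?add0e//.
  exact: (measure_eq0S (measurableI _ _ mB mN) mN (@subIsetr _ _ _) N0).
apply: (@le_trans _ _ (\sum_(0 <= k <oo) lam (B `&` first_entry k))).
  apply: measure_sigma_subadditive.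
  - by move=> n; exact: measurableI.
  - exact: measurableD.
  - move=> x [Bx nN].
    have [[k _ /first_entryP[j jx]]|nr] :=
      pselect ((\bigcup_k iter k.+1 T @^-1` B) x); first by exists j.
    by exfalso; apply: nN.
apply: lime_le; first exact: is_cvg_nneseries.
apply: nearW => n; apply: le_trans (bound n).
by rewrite leeDl.
Qed.

End excessive.

End recurrence.

(** * Uniqueness of invariant measures *)

Section uniqueness.
Context (R : realType) (d : measure_display) (X : measurableType d).
Context (m : probability X R) (T : X -> X).
Hypotheses (mT : measurable_fun setT T) (qiT : pushforward m T `<< m).
Hypotheses (cT : conservative m T) (eT : ergodic T m).
Implicit Types (mu nu lam : {measure set X -> \bar R}) (A B : set X).

Local Notation sfie := (sigma_finite_invariant_equivalent m T).

Lemma invariant_measure_iter mu n A : invariant_measure T mu ->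
  measurable A -> mu (iter n T @^-1` A) = mu A.
Proof.
move=> imu mA; elim: n => [//|n <-].
rewrite iter_preimageS.
by apply: imu; exact: measurable_iter_preimage.
Qed.

(** Let E carry the part of the space where [nu] is the smaller measure. The
    minimum of two invariant measures is excessive, hence invariant. If the
    complement of E is not null, it contains a non null set B with [mu B]
    finite; the minimum and [mu] give the same mass to B, hence to each of its
    preimages, so that [mu] and [nu] agree on the part of these preimages in E.
    As the preimages sweep out the space, [mu] and [nu] agree on E. *)
Lemma invariant_measures_comparable mu nu : sfie mu -> sfie nu ->
  (forall A, measurable A -> nu A <= mu A) \/
  (forall A, measurable A -> mu A <= nu A).
Proof.
move=> [sfmu imu [mum mmu]] [sfnu inu [num mnu]].
have [E [mE Emu Enu]] := sigma_finite_hahn sfmu sfnu.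
have mEC := measurableC mE.
have [EC0|EC0] := eqVneq (m (~` E)) 0.
  left=> A mA; rewrite (measure_setI_conull mA mE); last first.
    exact: null_dominatesP num mEC EC0.
  apply: (@le_trans _ _ (mu (A `&` E))); last exact: measureIl.
  by apply: Emu => //; exact: measurableI.
right.
pose lam : {measure set X -> \bar R} :=
  measure_add (mrestr nu mE) (mrestr mu mEC).
have lamE A : lam A = nu (A `&` E) + mu (A `&` ~` E) by exact: measure_addE.
have lam_nu A : measurable A -> lam A <= nu A.
  move=> mA; rewrite lamE (measure_setID nu mA mE) leeD2l//.
  by apply: Enu => //; exact: measurableI.
have lam_mu A : measurable A -> lam A <= mu A.
  move=> mA; rewrite lamE (measure_setID mu mA mE) leeD2r//.
  by apply: Emu => //; exact: measurableI.
have lam_m : lam `<< m.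
  apply/null_content_dominatesP => A mA A0.
  by apply/eqP; rewrite -measure_le0 -(null_dominatesP mum mA A0) lam_mu.
have lam_exc A : measurable A -> lam (T @^-1` A) <= lam A.
  move=> mA; have mTA := measurable_preimage mT.
  have [mAE mAEC] := (measurableI _ _ mA mE, measurableI _ _ mA mEC).
  have -> : T @^-1` A = T @^-1` (A `&` E) `|` T @^-1` (A `&` ~` E).
    by rewrite -preimage_setU -setIUr setUCr setIT.
  rewrite (le_trans (measureU2 _ (mTA _ mAE) (mTA _ mAEC)))// lamE.
  rewrite -(inu _ mAE) -(imu _ mAEC).
  by apply: leeD; [exact/lam_nu/mTA|exact/lam_mu/mTA].
have ilam : invariant_measure T lam.
  move=> A mA; rewrite /pushforward.
  exact: (excessive_invariant mT cT lam_m lam_exc mA).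
have [B [mB BE B0 Boo]] : exists B,
    [/\ measurable B, B `<=` ~` E, m B != 0 & mu B < +oo].
  apply: contrapT => noB; case: sfmu => F TF Ffin.
  move/eqP: EC0; apply.
  have -> : ~` E = \bigcup_n (~` E `&` F n) by rewrite -setI_bigcupr -TF setIT.
  have mEF n : measurable (~` E `&` F n).
    by apply: measurableI => //; have [] := Ffin n.
  apply: measure_bigcup_eq0 => // n; apply/eqP/negPn/negP => En0; apply: noB.
  exists (~` E `&` F n); split=> //.
  have [mF Foo] := Ffin n; apply: le_lt_trans Foo.
  by apply: le_measureS => //; exact: subIsetr.
pose P n := iter n T @^-1` B.
have mP n : measurable (P n) by exact: measurable_iter_preimage.
have mPE n : measurable (P n `&` E) by exact: measurableI.
have Poo n : mu (P n) < +oo by rewrite invariant_measure_iter.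
have finS A n : measurable A -> A `<=` P n -> mu A \is a fin_num.
  move=> mA AP; rewrite ge0_fin_numE//; apply: le_lt_trans (Poo n).
  exact: le_measureS.
have PE_eq n : nu (P n `&` E) = mu (P n `&` E).
  have : lam (P n) = mu (P n).
    rewrite !invariant_measure_iter// lamE (_ : B `&` E = set0) ?measure0 ?add0e.
      by rewrite (setIidl BE).
    by apply/seteqP; split=> // x [/BE].
  have fin : mu (P n `&` ~` E) \is a fin_num.
    by apply: (finS _ n); [exact: measurableI|exact: subIsetl].
  rewrite lamE (measure_setID mu (mP n) mE).
  by move/(congr1 (fun z => z - mu (P n `&` ~` E))); rewrite !addeK.
have le_PE n A : measurable A -> A `<=` P n `&` E -> mu A <= nu A.
  move=> mA AP; have := PE_eq n.
  have mPA := measurableD (mPE n) mA.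
  rewrite -(setDUK AP).
  rewrite !measureU ?setDIK//; try exact: mPA; move=> e.
  have finPA : mu (P n `&` E `\` A) \is a fin_num.
    by apply: (finS _ n) => // x [[]].
  rewrite -(leeD2rE _ _ finPA) -e leeD2l//.
  by apply: Emu => // x [[]].
move=> A mA.
rewrite (measure_setID mu mA mE) (measure_setID nu mA mE).
apply: leeD; last by apply: Enu => //; exact: measurableI.
have mAE := measurableI _ _ mA mE.
have PP : m (~` \bigcup_n seqDU P n) = 0.
  rewrite -seqDU_bigcup_eq; exact: (ergodic_sweep mT qiT).
have mdP n : measurable (seqDU P n) by exact: seqDU_measurable.
have mCP : measurable (~` \bigcup_n seqDU P n).
  by apply: measurableC; exact: bigcupT_measurable.
rewrite (measure_partition (D := seqDU P) (mu := mu))//; first last.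
- exact: null_dominatesP mum mCP PP.
rewrite (measure_partition (D := seqDU P) (mu := nu))//; first last.
- exact: null_dominatesP num mCP PP.
apply: lee_nneseries => // n _; apply: (le_PE n); first exact: measurableI.
by move=> x [[_ Ex] Px]; split=> //; exact: subset_seqDU Px.
Qed.

Lemma invariant_measure_scale mu (c : {nonneg R}) : (0 < c%:num)%R ->
  sfie mu -> sfie (mscale c mu).
Proof.
move=> c0 [[F TF Ffin] imu [/null_content_dominatesP mum mmu]]; split.
- exists F => // i; have [mF Foo] := Ffin i; split=> //.
  by rewrite /mscale lte_mul_pinfty// ge0_fin_numE.
- by move=> A mA; rewrite /pushforward /mscale -(imu A mA).
- split; apply/null_content_dominatesP => A mA.
    by move/(mum _ mA) => A0; rewrite /mscale A0 mule0.
  rewrite /mscale => /eqP; rewrite mule_eq0 eqe gt_eqF//= => /eqP.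
  exact: null_dominatesP mmu mA.
Qed.

Lemma invariant_measure_le_ratio mu nu B A : sfie mu -> sfie nu ->
  measurable B -> 0 < mu B < +oo -> 0 < nu B < +oo -> measurable A ->
  nu A <= (fine (nu B) / fine (mu B))%:E * mu A.
Proof.
move=> smu snu mB /andP[muB0 muBoo] /andP[nuB0 nuBoo] mA.
set c := (fine (nu B) / fine (mu B))%R.
have muBfin : mu B \is a fin_num by rewrite ge0_fin_numE.
have nuBfin : nu B \is a fin_num by rewrite ge0_fin_numE.
have fmu0 : (0 < fine (mu B))%R by rewrite fine_gt0// muB0.
have fnu0 : (0 < fine (nu B))%R by rewrite fine_gt0// nuB0.
have c0 : (0 < c)%R by exact: divr_gt0.
have key (c' : R) : (c < c')%R -> nu A <= c'%:E * mu A.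
  move=> cc'; have c'0 : (0 < c')%R by exact: lt_trans cc'.
  pose s : {nonneg R} := NngNum (ltW c'0).
  have [|/(_ B mB)] := invariant_measures_comparable
    (invariant_measure_scale (c := s) c'0 smu) snu; first exact.
  rewrite /= /mscale /= -[mu B](fineK muBfin) -[nu B](fineK nuBfin).
  rewrite -EFinM lee_fin.
  by rewrite leNgt -ltr_pdivrMr// cc'.
have [->|Aoo] := eqVneq (mu A) +oo; first by rewrite gt0_muley ?leey.
have Afin : mu A \is a fin_num by rewrite ge0_fin_numE// ltey.
apply/lee_addgt0Pr => e e0.
pose r := fine (mu A).
have r0 : (0 <= r)%R by rewrite fine_ge0.
apply: (le_trans (key (c + e / (r + 1))%R _)).
  by rewrite ltrDl divr_gt0// ltr_wpDl.
rewrite -(fineK Afin) -!EFinM -EFinD lee_fin mulrDl lerD2l.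
rewrite mulrAC ler_pdivrMr ?ltr_wpDl//.
by apply: ler_wpM2l; [exact: ltW|rewrite lerDl].
Qed.

Lemma invariant_measure_unique mu nu : sfie mu -> sfie nu ->
  exists2 c : R, (0 < c)%R & forall A, measurable A -> nu A = c%:E * mu A.
Proof.
move=> smu snu.
have [B [mB B0 muB nuB]] : exists B,
    [/\ measurable B, m B != 0, mu B < +oo & nu B < +oo].
  apply: contrapT => noB.
  have [[sfmu _ _] [sfnu _ _]] := (smu, snu).
  have [F [TF Ffin]] := common_sigma_finite_cover sfmu sfnu.
  suff : m setT = 0 by rewrite probability_setT => [[]] /eqP; rewrite oner_eq0.
  rewrite -TF; apply: measure_bigcup_eq0 => n; first by have [] := Ffin n.
  apply/eqP/negPn/negP => F0; apply: noB; exists (F n).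
  by have [] := Ffin n.
have pos lam : sfie lam -> 0 < lam B.
  move=> [_ _ [_ ml]]; rewrite lt0e measure_ge0 andbT.
  by apply: contra B0 => /eqP lB0; apply/eqP; exact: null_dominatesP ml mB lB0.
have [mu0 nu0] := (pos _ smu, pos _ snu).
have fmu : (0 < fine (mu B))%R by rewrite fine_gt0// mu0.
have fnu : (0 < fine (nu B))%R by rewrite fine_gt0// nu0.
exists (fine (nu B) / fine (mu B))%R => [|A mA]; first exact: divr_gt0.
apply/eqP; rewrite eq_le invariant_measure_le_ratio ?mu0 ?nu0//=.
have := @invariant_measure_le_ratio nu mu B A snu smu mB.
rewrite mu0 nu0 nuB muB => /(_ isT isT mA).
move=> /(lee_wpmul2l (x := (fine (nu B) / fine (mu B))%:E)) -/(_ _)/le_trans; apply.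
  by rewrite lee_fin divr_ge0// ltW.
by rewrite muleA -EFinM mulrA divfK ?gt_eqF// divff ?gt_eqF// mul1e.
Qed.

End uniqueness.

(** * Marco-Martens covers *)

Section marco_martens_theory.
Context (R : realType) (d : measure_display) (X : measurableType d).
Context (m : probability X R) (T : X -> X) (Xs : (set X)^nat).
Hypotheses (mT : measurable_fun setT T) (qiT : pushforward m T `<< m).
Hypothesis cover : marco_martens_cover m T Xs.
Implicit Types A B : set X.

(** All the measures involved being finite, these quantities are taken in R,
    where the quotients fed to a Banach limit live. *)
Definition hit n A : R := fine (m (iter n T @^-1` A)).

Definition occupation n A : R := (\sum_(0 <= k < n.+1) hit k A)%R.

Let mXs n : measurable (Xs n). Proof. exact: mm_measurable cover n. Qed.

Let mpre n A : measurable A -> measurable (iter n T @^-1` A).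
Proof. exact: measurable_iter_preimage. Qed.

Lemma hitE n A : measurable A -> (hit n A)%:E = m (iter n T @^-1` A).
Proof. by move=> mA; rewrite fineK// fin_num_measure//; exact: mpre. Qed.

Lemma hit0E A : measurable A -> m A = (hit 0 A)%:E.
Proof. by move=> mA; rewrite hitE. Qed.

Lemma hit_ge0 n A : (0 <= hit n A)%R.
Proof. exact: fine_ge0. Qed.

Lemma hit_le1 n A : measurable A -> (hit n A <= 1)%R.
Proof. by move=> mA; rewrite -lee_fin hitE// probability_le1//; exact: mpre. Qed.

Lemma hitU n A B : measurable A -> measurable B -> A `&` B = set0 ->
  hit n (A `|` B) = (hit n A + hit n B)%R.
Proof.
move=> mA mB AB; apply: EFin_inj.
rewrite EFinD !hitE//; last exact: measurableU.
rewrite preimage_setU measureU//; try exact: mpre.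
by rewrite -preimage_setI AB preimage_set0.
Qed.

Lemma le_hit n A B : measurable A -> measurable B -> A `<=` B ->
  (hit n A <= hit n B)%R.
Proof.
move=> mA mB AB; rewrite -lee_fin !hitE//.
by apply: le_measureS; [exact: mpre|exact: mpre|exact: preimage_subset].
Qed.

Lemma hit_preimage n s A : hit n (iter s T @^-1` A) = hit (n + s) A.
Proof.
rewrite /hit; congr (fine (m _)).
by apply/funext => x /=; rewrite addnC iterD.
Qed.

Lemma hit_null n A : measurable A -> m A = 0 -> hit n A = 0%R.
Proof. by move=> mA A0; apply: EFin_inj; rewrite hitE// null_iter_preimage. Qed.

Lemma occupation_ge0 n A : (0 <= occupation n A)%R.
Proof. by apply: sumr_ge0 => k _; exact: hit_ge0. Qed.

Lemma occupationU n A B : measurable A -> measurable B -> A `&` B = set0 ->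
  occupation n (A `|` B) = (occupation n A + occupation n B)%R.
Proof.
by move=> mA mB AB; rewrite -big_split; apply: eq_bigr => k _; exact: hitU.
Qed.

Lemma le_occupation n A B : measurable A -> measurable B -> A `<=` B ->
  (occupation n A <= occupation n B)%R.
Proof. by move=> mA mB AB; apply: ler_sum => k _; exact: le_hit. Qed.

Lemma le_occupation_nat n p A : (n <= p)%N ->
  (occupation n A <= occupation p A)%R.
Proof.
move=> np; rewrite /occupation (big_cat_nat _ (n := n.+1) (p := p.+1))//=.
by rewrite lerDl sumr_ge0// => k _; exact: hit_ge0.
Qed.

Lemma occupation_delay n s A : measurable A ->
  (\sum_(0 <= k < n.+1) hit (k + s) A <= occupation n A + s%:R)%R.
Proof.
move=> mA; elim: s => [|s IHs].
  by rewrite addr0; under eq_bigr do rewrite addn0.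
have -> : (\sum_(0 <= k < n.+1) hit (k + s.+1) A =
    \sum_(0 <= k < n.+1) hit (k + s) A + hit (n.+1 + s) A - hit s A)%R.
  rewrite -big_nat_recr// big_nat_recl//= add0n addrAC subrr add0r.
  by apply: eq_bigr => k _; rewrite addSnnS.
rewrite -natr1 addrA lerBlDr (le_trans (lerD IHs (hit_le1 _ mA)))//.
by rewrite lerDl hit_ge0.
Qed.

Lemma cover_gt0 j : (0 < hit 0 (Xs j))%R.
Proof.
have [s js0] := mm_transitive cover j j.
rewrite -lte_fin hitE//; apply: lt_le_trans js0 _.
by apply: measureIl => //; exact: mpre.
Qed.

Lemma occupation0_gt0 n : (0 < occupation n (Xs 0%N))%R.
Proof.
apply: lt_le_trans (cover_gt0 0) _.
apply: le_trans (le_occupation_nat (Xs 0%N) (leq0n n)).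
by rewrite /occupation big_nat1.
Qed.

Lemma occupation0_unbounded (M : R) : exists n, (M < occupation n (Xs 0%N))%R.
Proof.
apply: contrapT => /forallNP hM.
have : \sum_(0 <= n <oo) m (iter n T @^-1` Xs 0%N) <= M%:E.
  apply: lime_le; first exact: is_cvg_nneseries.
  apply: nearW => n.
  under eq_bigr do rewrite -hitE//.
  rewrite sumEFin lee_fin; apply: (@le_trans _ _ (occupation n (Xs 0%N))).
    by rewrite /occupation big_nat_recr//= lerDl hit_ge0.
  by rewrite leNgt; exact/negP/hM.
by rewrite (mm_divergent cover).
Qed.

Lemma bounded_div_occupation0 (u : R^nat) (M : R) : (forall n, `|u n| <= M)%R ->
  (u n / occupation n.+1 (Xs 0%N))%R @[n --> \oo] --> (0%R : R).
Proof.
move=> uM; apply/cvgr0Pnorm_le => e e0.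
have [N hN] := occupation0_unbounded (M / e).
exists N => // n /= Nn.
have o0 := occupation0_gt0 n.+1.
rewrite normrM normfV (gtr0_norm o0) ler_pdivrMr//.
rewrite (le_trans (uM n))// mulrC -ler_pdivrMr// (le_trans (ltW hN))//.
by apply: le_occupation_nat; exact: leqW.
Qed.

Lemma hit_distortion j : exists2 K : R, (1 <= K)%R & forall A B,
  measurable A -> measurable B -> A `<=` Xs j -> B `<=` Xs j -> forall n,
  (hit n A * hit 0 B <= K * (hit 0 A * hit n B))%R.
Proof.
have [K K1 hK] := mm_distortion cover j; exists K => // A B mA mB AX BX n.
rewrite -lee_fin !EFinM !hitE//; exact: hK.
Qed.

(** Let B be the part of [X_j] that is in [X_0] after [s] steps, of positive
    measure for some [s].  By bounded distortion on [X_j], visits to A at time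
    [k] are at most a multiple of [m A] times visits to B at time [k], hence
    times visits to [X_0] at time [k + s]; shifting an occupation sum by [s]
    changes it by at most [s], which is in turn at most a multiple of
    [S_n(X_0)], as the latter is at least [m X_0]. *)
Lemma occupation_le j : exists2 C : R, (0 <= C)%R & forall A,
  measurable A -> A `<=` Xs j -> forall n,
  (occupation n A <= C * hit 0 A * occupation n (Xs 0%N))%R.
Proof.
have [s b0] := mm_transitive cover j 0.
have [K K1 hK] := hit_distortion j.
have K0 : (0 < K)%R by exact: lt_le_trans K1.
set B := Xs j `&` _ in b0.
have mB : measurable B by apply: measurableI => //; exact: mpre.
have {}b0 : (0 < hit 0 B)%R by rewrite -lte_fin hitE.
have q0 := cover_gt0 0.
pose D := (1 + s%:R / hit 0 (Xs 0%N))%R.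
have D0 : (0 <= D)%R by rewrite addr_ge0// divr_ge0// ltW.
exists (K * D / hit 0 B)%R => [|A mA AX n].
  by rewrite divr_ge0// ?mulr_ge0// ltW.
rewrite mulrAC -mulrA mulrAC ler_pdivlMr// /occupation mulr_suml.
apply: (@le_trans _ _
    (\sum_(0 <= k < n.+1) K * hit 0 A * hit (k + s) (Xs 0%N))%R).
  apply: ler_sum => k _; apply: le_trans (hK A B mA mB AX (@subIsetl _ _ _) k) _.
  rewrite mulrA ler_wpM2l ?mulr_ge0 ?hit_ge0 ?(ltW K0)// -(hit_preimage k s).
  by apply: le_hit => //; [exact: mpre|exact: subIsetr].
rewrite -mulr_sumr -/(occupation n (Xs 0%N)).
apply: (@le_trans _ _ (K * hit 0 A * (occupation n (Xs 0%N) + s%:R))%R).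
  rewrite ler_wpM2l ?mulr_ge0 ?hit_ge0 ?(ltW K0)//.
  exact: occupation_delay.
rewrite [leRHS](_ : _ = K * hit 0 A * (D * occupation n (Xs 0%N)))%R; last first.
  by ring.
rewrite ler_wpM2l ?mulr_ge0 ?hit_ge0 ?(ltW K0)//.
rewrite /D mulrDl mul1r lerD2l mulrAC ler_pdivlMr// ler_wpM2l//.
have := le_occupation_nat (Xs 0%N) (leq0n n).
by rewrite {1}/occupation big_nat1.
Qed.

(** The same comparison in the other direction, from [X_0] to [X_j] in [s] steps,
    then from [X_j] to A by distortion.  The error [s] is kept: it does not
    depend on A and disappears after division by the divergent [S_n(X_0)]. *)
Lemma occupation_ge j : exists2 c : R, (0 < c)%R & exists s : nat, forall A,
  measurable A -> A `<=` Xs j -> forall n,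
  (c * hit 0 A * occupation n (Xs 0%N) - s%:R <= occupation n A)%R.
Proof.
have [s b0] := mm_transitive cover 0 j.
have [K K1 hK] := hit_distortion 0; have [L L1 hL] := hit_distortion j.
have K0 : (0 < K)%R by exact: lt_le_trans K1.
have L0 : (0 < L)%R by exact: lt_le_trans L1.
set B := Xs 0%N `&` _ in b0.
have mB : measurable B by apply: measurableI => //; exact: mpre.
have {}b0 : (0 < hit 0 B)%R by rewrite -lte_fin hitE.
exists (hit 0 B / (K * L))%R; first by rewrite divr_gt0// mulr_gt0.
exists s => A mA AX n; rewrite lerBlDr.
apply: le_trans (occupation_delay n s mA).
rewrite /occupation mulr_sumr; apply: ler_sum => k _.
have h1 : (hit k (Xs 0%N) * hit 0 B <= K * hit (k + s) (Xs j))%R.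
  apply: le_trans (hK _ _ (mXs 0%N) mB (fun _ => id) (@subIsetl _ _ _) k) _.
  rewrite ler_wpM2l ?(ltW K0) ?(ltW L0)// -[leRHS]mul1r ler_pM ?hit_ge0 ?hit_le1//.
  rewrite -(hit_preimage k s).
  by apply: le_hit => //; [exact: mpre|exact: subIsetr].
have h2 : (hit (k + s) (Xs j) * hit 0 A <= L * hit (k + s) A)%R.
  apply: le_trans (hL _ _ (mXs j) mA (fun _ => id) AX (k + s)%N) _.
  rewrite ler_wpM2l ?(ltW L0)// -[leRHS]mul1r.
  by rewrite ler_wpM2r ?hit_ge0 ?hit_le1.
rewrite [leLHS](_ : _ =
    hit k (Xs 0%N) * hit 0 B * hit 0 A / (K * L))%R; last first.
  by ring.
rewrite ler_pdivrMr ?mulr_gt0//.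
apply: (@le_trans _ _ (K * (hit (k + s) (Xs j) * hit 0 A))%R).
  by rewrite mulrA ler_wpM2r ?hit_ge0.
rewrite [leRHS](_ : _ = K * (L * hit (k + s) A))%R; last by ring.
by rewrite ler_wpM2l ?(ltW K0).
Qed.


Lemma occupation_disjoint_le1 n A : measurable A ->
  trivIset setT (fun k => iter k T @^-1` A) -> (occupation n A <= 1)%R.
Proof.
move=> mA tA; rewrite -lee_fin /occupation -sumEFin.
under eq_bigr do rewrite hitE//.
have mU : measurable (\big[setU/set0]_(k < n.+1) (iter k T @^-1` A)).
  by apply: bigsetU_measurable => k _; exact: mpre.
rewrite big_mkord.
rewrite -(@measure_semi_additive_ord_I _ _ _ m (fun k => iter k T @^-1` A))//.
- exact: probability_le1.
- by move=> k _; exact: mpre.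
- exact: sub_trivIset tA.
Qed.

(** The preimages of a wandering set are disjoint, so its occupation sums stay
    bounded; by bounded distortion those of a wandering set of positive measure
    would be comparable to those of [X_0], which diverge. *)
Lemma cover_conservative : conservative m T.
Proof.
move=> A mA; set W := never_return T A.
have mW : measurable W by exact: measurable_never_return.
have mWX j : measurable (W `&` Xs j) by exact: measurableI.
rewrite (measure_setI_conull mW (bigcupT_measurable _ mXs) (mm_cover cover)).
rewrite setI_bigcupr; apply: measure_bigcup_eq0 => // j.
have [c c0 [s hc]] := occupation_ge j.
transitivity (hit 0 (W `&` Xs j))%:E; first exact: hit0E.
congr EFin; apply/eqP; rewrite eq_le hit_ge0 andbT leNgt; apply/negP => w0.
have cw0 : (0 < c * hit 0 (W `&` Xs j))%R by exact: mulr_gt0.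
have [n] := occupation0_unbounded ((1 + s%:R) / (c * hit 0 (W `&` Xs j)))%R.
apply/negP; rewrite -leNgt ler_pdivlMr// mulrC -lerBlDr.
apply: le_trans (hc _ (mWX j) (@subIsetr _ _ _) n) _.
apply: occupation_disjoint_le1 => //.
have dis k p x : (k < p)%N -> W (iter k T x) -> A (iter p T x) -> False.
  move=> kp [_ nA] Ap; apply: nA; exists (p - k).-1 => //=.
  by rewrite -iterS prednK ?subn_gt0// -iterD subnK// ltnW.
apply/trivIsetP => k p _ _ kp; apply/seteqP; split=> // x [[Wk _] [Wp _]].
move: kp; rewrite neq_ltn => /orP[kp|pk].
  by apply: dis kp Wk _; case: Wp.
by apply: dis pk Wp _; case: Wk.
Qed.

Section banach_limit_measure.
Context (lB : R^nat -> R).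
Hypothesis lBP : banach_limit lB.
Hypothesis imT : forall A, measurable A -> measurable (T @` A).

Local Notation Y := (seqDU Xs).
Local Notation ratio := (mm_seq m T Xs).
Local Notation loc A := (lB (ratio A)).
Local Notation tail l := (\bigcup_(j >= l) Y j).

Let mY j : measurable (Y j). Proof. exact: seqDU_measurable. Qed.

Let tY : trivIset setT Y. Proof. exact: trivIset_seqDU. Qed.

Let YX j : Y j `<=` Xs j. Proof. exact: subset_seqDU. Qed.

Let mtail l : measurable (tail l).
Proof. by apply: bigcup_measurable => j _. Qed.

Let Y0 : m (~` \bigcup_j Y j) = 0.
Proof. by rewrite -seqDU_bigcup_eq; exact: mm_cover cover. Qed.

Lemma ratioE A n :
  ratio A n = (occupation n.+1 A / occupation n.+1 (Xs 0%N))%R.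
Proof. by []. Qed.

Lemma ratio_ge0 A n : (0 <= ratio A n)%R.
Proof. by rewrite ratioE divr_ge0// occupation_ge0. Qed.

Lemma le_ratio A B n : measurable A -> measurable B -> A `<=` B ->
  (ratio A n <= ratio B n)%R.
Proof.
move=> mA mB AB; rewrite !ratioE ler_wpM2r ?invr_ge0 ?occupation_ge0//.
exact: le_occupation.
Qed.

Lemma ratioU A B : measurable A -> measurable B -> A `&` B = set0 ->
  ratio (A `|` B) = (fun n => ratio A n + ratio B n)%R.
Proof.
by move=> mA mB AB; apply/funext => n; rewrite !ratioE occupationU// mulrDl.
Qed.

Lemma ratio_null A : measurable A -> m A = 0 -> ratio A = (fun=> 0%R).
Proof.
move=> mA A0; apply/funext => n; rewrite ratioE /occupation big1 ?mul0r// => k _.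
exact: hit_null.
Qed.

Lemma ratio_boundedP A : bounded_fun (ratio A) <->
  exists M, forall n, (ratio A n <= M)%R.
Proof.
split=> [/bounded_seqP[M uM]|[M uM]].
  by exists M => n; rewrite (le_trans (ler_norm _)).
by apply/bounded_seqP; exists M => n; rewrite ger0_norm ?ratio_ge0.
Qed.

Lemma ratio_boundedS A B : measurable A -> measurable B -> A `<=` B ->
  bounded_fun (ratio B) -> bounded_fun (ratio A).
Proof.
move=> mA mB AB /ratio_boundedP[M uM]; apply/ratio_boundedP; exists M => n.
by apply: le_trans (uM n); exact: le_ratio.
Qed.

Lemma ratio_bounded j A : measurable A -> A `<=` Xs j -> bounded_fun (ratio A).
Proof.
move=> mA AX; have [C C0 hC] := occupation_le j.
apply/ratio_boundedP; exists (C * hit 0 A)%R => n.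
by rewrite ratioE ler_pdivrMr ?occupation0_gt0//; exact: hC.
Qed.

Lemma loc_ge0 A : bounded_fun (ratio A) -> (0 <= loc A)%R.
Proof.
by move=> bA; apply: (banach_limit_ge0 lBP) => // n; exact: ratio_ge0.
Qed.

Lemma loc_null A : measurable A -> m A = 0 -> loc A = 0%R.
Proof. by move=> mA A0; rewrite ratio_null// banach_limit_cst. Qed.

Lemma le_loc A B : measurable A -> measurable B -> A `<=` B ->
  bounded_fun (ratio B) -> (loc A <= loc B)%R.
Proof.
move=> mA mB AB bB; apply: (le_banach_limit lBP) => //.
  exact: ratio_boundedS bB.
by move=> n; exact: le_ratio.
Qed.

Lemma locU A B : measurable A -> measurable B -> A `&` B = set0 ->
  bounded_fun (ratio A) -> bounded_fun (ratio B) ->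
  loc (A `|` B) = (loc A + loc B)%R.
Proof. by move=> mA mB AB bA bB; rewrite ratioU// banach_limitD. Qed.

Lemma loc_le j : exists2 C : R, (0 <= C)%R & forall A,
  measurable A -> A `<=` Xs j -> (loc A)%:E <= C%:E * m A.
Proof.
have [C C0 hC] := occupation_le j; exists C => // A mA AX.
rewrite hit0E// -EFinM lee_fin -(banach_limit_cst lBP (C * hit 0 A)).
apply: (le_banach_limit lBP); first exact: ratio_bounded AX.
  by apply/bounded_seqP; exists `|C * hit 0 A|%R.
by move=> n; rewrite ratioE ler_pdivrMr ?occupation0_gt0//; exact: hC.
Qed.

Lemma loc_ge j : exists2 c : R, (0 < c)%R & forall A,
  measurable A -> A `<=` Xs j -> c%:E * m A <= (loc A)%:E.
Proof.
have [c c0 [s hc]] := occupation_ge j; exists c => // A mA AX.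
rewrite hit0E// -EFinM lee_fin.
pose u n : R := (s%:R / occupation n.+1 (Xs 0%N))%R.
have u0 : u @ \oo --> (0%R : R).
  by apply: (bounded_div_occupation0 (u := fun=> s%:R)) => n; exact: lexx.
have bA := ratio_bounded mA AX.
have bu : bounded_fun u by apply: cvg_seq_bounded; apply/cvg_ex; exists 0%R.
rewrite -(banach_limit_cst lBP (c * hit 0 A)) -[leRHS]addr0.
rewrite -(banach_limit_lim lBP u0) -banach_limitD//.
apply: (le_banach_limit lBP).
- by apply/bounded_seqP; exists `|c * hit 0 A|%R.
- by apply: bounded_seqD.
- move=> n; rewrite ratioE /u -mulrDl ler_pdivlMr ?occupation0_gt0//.
  by rewrite -lerBlDr; exact: hc.
Qed.

(** Replacing A by its preimage shifts the occupation sum by one step, which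
    changes it by a bounded amount. *)
Lemma loc_preimage A : measurable A -> bounded_fun (ratio A) ->
  bounded_fun (ratio (T @^-1` A)) /\ loc (T @^-1` A) = loc A.
Proof.
move=> mA bA.
have d0 : (fun n => ratio (T @^-1` A) n - ratio A n)%R @ \oo --> (0%R : R).
  have -> : (fun n => ratio (T @^-1` A) n - ratio A n)%R =
      (fun n => (hit n.+2 A - hit 0 A) / occupation n.+1 (Xs 0%N))%R.
    apply/funext => n; rewrite !ratioE -mulrBl; congr (_ / _)%R.
    have -> : occupation n.+1 (T @^-1` A) =
        (\sum_(0 <= k < n.+2) hit k.+1 A)%R.
      by apply: eq_bigr => k _; rewrite -addn1 -(hit_preimage k 1).
    have : (hit 0 A + \sum_(0 <= k < n.+2) hit k.+1 A =
            occupation n.+1 A + hit n.+2 A)%R.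
      by rewrite -(big_nat_recl _ _ (fun k => hit k A))// -big_nat_recr.
    lra.
  apply: (@bounded_div_occupation0 (fun n => hit n.+2 A - hit 0 A)%R 2%R).
  move=> n; rewrite (le_trans (ler_normB _ _))// !ger0_norm ?hit_ge0//.
  by rewrite (_ : 2%R = 1 + 1 :> R)%R// lerD// hit_le1.
split; last exact: (banach_limit_asymptotic lBP).
have bd : bounded_fun (fun n => ratio (T @^-1` A) n - ratio A n)%R.
  by apply: cvg_seq_bounded; apply/cvg_ex; exists 0%R.
have := bounded_seqD bd bA; rewrite (_ : (fun n => _) = ratio (T @^-1` A))//.
by apply/funext => n; rewrite subrK.
Qed.

Lemma mm_measure_local j A : measurable A -> A `<=` Y j ->
  mm_measure m T Xs lB A = mm_local m T Xs lB A.
Proof.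
move=> mA AY; have AYi i : i != j -> A `&` Y i = set0.
  move=> ij; apply/seteqP; split=> // x [/AY Yjx Yix].
  by move/eqP: ij; apply; apply: tY => //; exists x.
have loc0 : loc set0 = 0%R by exact: loc_null.
rewrite /mm_measure (nneseriesD1 (n := j)) => [|n _|//]; last first.
  rewrite /mm_local lee_fin; apply: loc_ge0; apply: (ratio_bounded (j := n)).
    exact: measurableI.
  by apply: subset_trans (@YX n); exact: subIsetr.
rewrite (setIidl AY) eseries0 ?adde0// => i _ /= ij.
by rewrite AYi// /mm_local loc0.
Qed.

Lemma exists_mm_measure : exists mu : {measure set X -> \bar R},
  forall A, measurable A -> mu A = mm_measure m T Xs lB A.
Proof.
have /choice[mu_ mu_E] j : exists mu : {measure set X -> \bar R},
    forall A, measurable A -> mu A = mm_local m T Xs lB (A `&` Y j).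
  have [C C0 hC] := loc_le j.
  have sub A : A `&` Y j `<=` Xs j.
    by apply: subset_trans (@YX j); exact: subIsetr.
  have bdd A : measurable A -> bounded_fun (ratio (A `&` Y j)).
    by move=> mA; apply: ratio_bounded (sub A); exact: measurableI.
  apply: (@dominated_additive_measure _ _ _ m _ C) => [A mA|A B mA mB AB|A mA].
  - by apply: loc_ge0; exact: bdd.
  - rewrite setIUl locU//; try exact: measurableI; try exact: bdd.
    by rewrite setIACA AB set0I.
  - apply: le_trans (hC _ _ (sub A)) _; first exact: measurableI.
    by rewrite lee_wpmul2l ?lee_fin//; apply: measureIl.
exists (mseries mu_ 0) => A mA.
by apply: eq_eseriesr => j _; exact: mu_E.
Qed.

Section limit_measure.
Context (mu : {measure set X -> \bar R}).
Hypothesis muE : forall A, measurable A -> mu A = mm_measure m T Xs lB A.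

Lemma limit_measure_local j A : measurable A -> A `<=` Y j ->
  mu A = (loc A)%:E.
Proof. by move=> mA AY; rewrite muE// (mm_measure_local mA AY). Qed.

Lemma limit_measure_equivalent : equivalent_measures mu m.
Proof.
split; apply/null_content_dominatesP => A mA A0.
  rewrite muE//; apply: eseries0 => j _ _.
  rewrite /mm_local loc_null//; first exact: measurableI.
  by apply: measure_eq0S A0 => //; exact: measurableI.
rewrite (measure_partition (D := Y) mY tY mA Y0); apply: eseries0 => j _ _.
have mAY : measurable (A `&` Y j) by exact: measurableI.
have [c c0 hc] := loc_ge j.
apply/eqP; rewrite eq_le measure_ge0 andbT -(pmule_rle0 _ (x := c%:E))//.
apply: le_trans (hc _ mAY _) _; first by move=> x [_ /YX].
rewrite -(limit_measure_local mAY (@subIsetr _ _ _)) -A0.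
exact: measureIl.
Qed.

Lemma limit_measure_partition A : measurable A ->
  mu A = \sum_(0 <= j <oo) (loc (A `&` Y j))%:E.
Proof. by move=> mA; rewrite muE. Qed.

Lemma limit_measure_local_lty j : mu (Y j) < +oo.
Proof. by rewrite (limit_measure_local (mY j) (fun _ => id)) ltry. Qed.

Lemma limit_measure_cover j : 0 < mu (Xs j) < +oo.
Proof.
have [mum mmu] := limit_measure_equivalent; apply/andP; split.
  rewrite lt0e measure_ge0 andbT; apply/eqP => /(null_dominatesP mmu (mXs j)) X0.
  have := cover_gt0 j; rewrite -lte_fin -hit0E//.
  by rewrite [X in _ < X]X0 ltxx.
have mU : measurable (\big[setU/set0]_(k < j.+1) Y k).
  by apply: bigsetU_measurable => k _; exact: mY.
apply: (@le_lt_trans _ _ (mu (\big[setU/set0]_(k < j.+1) Y k))).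
  apply: le_measureS => //; rewrite -bigsetU_seqDU.
  by rewrite big_ord_recr/=; exact: subsetUr.
apply: le_lt_trans (Boole_inequality mu _) _ => //.
by apply/lte_sum_pinfty => k _; exact: limit_measure_local_lty.
Qed.

Lemma limit_measure_sigma_finite : sigma_finite setT mu.
Proof.
have mUY := bigcupT_measurable _ mY.
exists (fun n => if n is j.+1 then Y j else ~` \bigcup_j Y j).
  apply/seteqP; split=> // x _; have [[j _ Yjx]|nY] := pselect ((\bigcup_j Y j) x).
    by exists j.+1.
  by exists 0%N.
case=> [|j]; last by split=> //; exact: limit_measure_local_lty.
have mC := measurableC mUY; split=> //.
by rewrite (null_dominatesP limit_measure_equivalent.1 mC Y0).
Qed.

(** Peeling off [Y l] from the tail is additive, so the functional of the
    tails is the functional of A minus the partial sums of the series that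
    defines the measure. *)
Lemma limit_measure_tail A : measurable A -> bounded_fun (ratio A) ->
  cvgn (fun l => loc (A `&` tail l)) /\
  mu A = (loc A - limn (fun l => loc (A `&` tail l)))%:E.
Proof.
move=> mA bA; pose a j := loc (A `&` Y j).
have mAY j : measurable (A `&` Y j) by exact: measurableI.
have mAt l : measurable (A `&` tail l) by exact: measurableI.
have bAY j : bounded_fun (ratio (A `&` Y j)).
  by apply: ratio_boundedS bA => //; exact: subIsetl.
have bAt l : bounded_fun (ratio (A `&` tail l)).
  by apply: ratio_boundedS bA => //; exact: subIsetl.
have tail0 : loc (A `&` tail 0) = loc A.
  have mC := measurableC (mtail 0).
  have mt0 : measurable (A `&` ~` tail 0) by exact: measurableI.
  have nul : m (A `&` ~` tail 0) = 0.
    by apply: measure_eq0S (@subIsetr _ _ _) _ => //; rewrite bigcup_ge0.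
  rewrite -[in RHS](setIT A) -(setUv (tail 0)) setIUr locU//.
  - by rewrite (loc_null mt0 nul) addr0.
  - by rewrite setIACA setICr setI0.
  - by rewrite ratio_null//; apply/bounded_seqP; exists 0%R => n; rewrite normr0.
have tailS l : loc (A `&` tail l) = (a l + loc (A `&` tail l.+1))%R.
  rewrite /a -locU//; first by rewrite -setIUr -bigcup_geS.
  by rewrite setIACA trivIset_bigcup_geS ?setI0.
have tailE : (fun l => loc (A `&` tail l)) = (fun l => loc A - series a l)%R.
  apply/funext; elim=> [|l IHl]; first by rewrite tail0 /series/= big_nil subr0.
  by rewrite seriesSr opprD addrA -IHl (tailS l) addrAC subrr add0r.
have a0 j : (0 <= a j)%R by exact: loc_ge0.
have ca : cvgn (series a).
  apply: nondecreasing_is_cvgn; first exact: nondecreasing_series.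
  exists (loc A) => _ [l _ <-]; rewrite -subr_ge0.
  by have := loc_ge0 (bAt l); rewrite (congr1 (@^~ l) tailE).
have cta : (fun l => loc A - series a l)%R @ \oo --> (loc A - limn (series a))%R.
  by apply: cvgB => //; exact: cvg_cst.
rewrite tailE; split; first by apply/cvg_ex; eexists; exact: cta.
rewrite (cvg_lim _ cta)// subKr limit_measure_partition//.
rewrite -EFin_lim//; congr (lim (_ @ \oo)).
by apply/funext => n; rewrite /= sumEFin.
Qed.

(** No mass of the preimage of A escapes through the tails of the cover: the part
    of it in the cells from [Y l] on lies in the preimage of the intersection
    of A with the image of these cells, whose measure tends to 0. *)
Lemma limit_measure_preimage_local j A : measurable A -> A `<=` Y j ->
  mu (T @^-1` A) = mu A.
Proof.
move=> mA AY; have AX : A `<=` Xs j by exact: subset_trans (@YX j).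
have bA := ratio_bounded mA AX.
have [bTA TAE] := loc_preimage mA bA.
have mTA := measurable_preimage mT mA.
have [_ ->] := limit_measure_tail mTA bTA.
rewrite (limit_measure_local mA AY) TAE; congr EFin.
suff tail0 : (fun l => loc (T @^-1` A `&` tail l)) @ \oo --> (0%R : R).
  by rewrite (cvg_lim _ tail0)// subr0.
have [C C0 hC] := loc_le j.
have mtl l : measurable (T @` tail l) by exact: imT.
have mAT l : measurable (A `&` T @` tail l) by exact: measurableI.
have C0cvg : (fun l => C * fine (m (T @` tail l)))%R @ \oo --> (0%R : R).
  rewrite -[X in _ --> X](mulr0 C); apply: cvgM; first exact: cvg_cst.
  exact: (fine_cvg (mm_tail cover)).
apply: (squeeze_cvgr _ (cvg_cst (0%R : R)) C0cvg); apply: nearW => l.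
have mTl : measurable (T @^-1` A `&` tail l) by exact: measurableI.
apply/andP; split.
  apply: loc_ge0; apply: ratio_boundedS bTA => //; exact: subIsetl.
have ATX : A `&` T @` tail l `<=` Xs j by move=> x [/AX].
have bAT := ratio_bounded (mAT l) ATX.
have [bTAT TATE] := loc_preimage (mAT l) bAT.
apply: (@le_trans _ _ (loc (T @^-1` (A `&` T @` tail l)))).
  apply: le_loc => //; first exact: measurable_preimage.
  by move=> x [Ax tx]; split=> //; exists x.
rewrite TATE -lee_fin EFinM fineK; last exact: fin_num_measure.
apply: le_trans (hC _ (mAT l) ATX) _.
by rewrite lee_wpmul2l ?lee_fin//; apply: measureIr.
Qed.

Lemma limit_measure_invariant : invariant_measure T mu.
Proof.
move=> A mA; rewrite /pushforward.
have mTY j : measurable (T @^-1` Y j) by exact: measurable_preimage.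
have tTY : trivIset setT (fun j => T @^-1` Y j).
  by move=> i k _ _ [x [Yi Yk]]; apply: tY => //; exists (T x).
have mNC : measurable (~` \bigcup_j Y j).
  by apply: measurableC; exact: bigcupT_measurable.
have mum := limit_measure_equivalent.1.
have Ymu : mu (~` \bigcup_j Y j) = 0 by exact: null_dominatesP mum mNC Y0.
have TYmu : mu (~` \bigcup_j T @^-1` Y j) = 0.
  rewrite -preimage_bigcup preimage_setC.
  apply: null_dominatesP mum _ _; first exact: measurable_preimage.
  exact: null_preimage.
rewrite (measure_partition mTY tTY _ TYmu); last exact: measurable_preimage.
rewrite (measure_partition mY tY mA Ymu); apply: eq_eseriesr => j _.
rewrite -preimage_setI; apply: (limit_measure_preimage_local (j := j)).
  exact: measurableI.
exact: subIsetr.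
Qed.

Lemma limit_measure_sigma_finite_invariant_equivalent :
  sigma_finite_invariant_equivalent m T mu.
Proof.
split; [exact: limit_measure_sigma_finite|exact: limit_measure_invariant|].
exact: limit_measure_equivalent.
Qed.

End limit_measure.

End banach_limit_measure.

End marco_martens_theory.

(** * Existence and uniqueness of the invariant measure *)

Theorem theorem8p13 (R : realType) (d : measure_display) (X : measurableType d)
    (m : probability X R) (T : X -> X) (Xs : (set X)^nat)
    (mmT : marco_martens_map m T) (mmX : marco_martens_cover m T Xs) :
  (exists mu : {measure set X -> \bar R},
     sigma_finite_invariant_equivalent m T mu /\
     forall j, 0 < mu (Xs j) < +oo) /\
  (forall lB : R^nat -> R, banach_limit lB ->
     (forall (j : nat) (A : set X), measurable A -> A `<=` seqDU Xs j ->
        bounded_fun (mm_seq m T Xs A) /\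
        mm_measure m T Xs lB A = mm_local m T Xs lB A) /\
     exists mu : {measure set X -> \bar R},
       [/\ (forall A, measurable A -> mu A = mm_measure m T Xs lB A),
           sigma_finite_invariant_equivalent m T mu,
           (forall j, 0 < mu (Xs j) < +oo) &
           forall A, measurable A -> bounded_fun (mm_seq m T Xs A) ->
             let tail (l : nat) : R :=
               lB (mm_seq m T Xs (A `&` \bigcup_(j >= l) seqDU Xs j)) in
             cvgn tail /\
             mu A = (lB (mm_seq m T Xs A) - limn tail)%:E]) /\
  (forall mu : {measure set X -> \bar R},
     sigma_finite_invariant_equivalent m T mu ->
     (ergodic T m <-> ergodic T mu) /\
     (ergodic T m ->
      forall nu : {measure set X -> \bar R},
        sigma_finite_invariant_equivalent m T nu ->
        exists2 c : R, (0 < c)%R &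
          forall A, measurable A -> nu A = c%:E * mu A)).
Proof.
have [mT imT qiT _] := mmT.
have limit (lB : R^nat -> R) (lBP : banach_limit lB) :=
  exists_mm_measure mT mmX lBP.
split; last split.
- have [lB lBP] := exists_banach_limit R.
  have [mu muE] := limit _ lBP; exists mu; split.
    exact: (limit_measure_sigma_finite_invariant_equivalent
      mT qiT mmX lBP imT muE).
  by move=> j; exact: (limit_measure_cover mT qiT mmX lBP muE).
- move=> lB lBP; split=> [j A mA AY|].
    split; last exact: (mm_measure_local mT qiT mmX lBP mA AY).
    apply: (ratio_bounded mT mmX mA (j := j)).
    exact: subset_trans AY (@subset_seqDU _ _ _).
  have [mu muE] := limit _ lBP; exists mu; split=> //.
  + exact: (limit_measure_sigma_finite_invariant_equivalent
      mT qiT mmX lBP imT muE).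
  + by move=> j; exact: (limit_measure_cover mT qiT mmX lBP muE).
  + by move=> A mA bA; exact: (limit_measure_tail mT qiT mmX lBP muE mA bA).
- move=> mu smu; split=> [|em nu snu].
    have [_ _ [mum mmu]] := smu.
    by split=> e A mA TA; have mAC := measurableC mA;
      case: (e A mA TA) => A0; [left|right|left|right];
      apply: null_dominatesP A0.
  have cT := cover_conservative mT mmX.
  exact: (invariant_measure_unique mT qiT cT em smu snu).
Qed.
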